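(* For positive integers $m,p$ and an integer $q>1$, \begin{align*} &(-1)^{m-1} \sum_{\substack{i+j=p-1\\ i,j\geq 0}} \binom{m+i-1}{i}\binom{q+j-1}{j} \sum_{n=1}^\infty \frac{H_{n-1}^{(m+i)}}{(n-1/2)^{q+j}}+(-1)^{p-1} \sum_{\substack{i+j=m-1\\ i,j\geq 0}} \binom{p+i-1}{i}\binom{q+j-1}{j} \sum_{n=1}^\infty \frac{H_{n-1}^{(p+i)}}{(n-1/2)^{q+j}}\\ &=\binom{p+q+m-2}{q-1}\widetilde{t}(p+q+m-1) + \sum_{\substack{i+j=p-1\\ i,j\geq 0}} \binom{m+i-1}{i}\binom{q+j-1}{j} (-1)^i \zeta(m+i)\widetilde{t}(q+j)\\ &\quad+\sum_{\substack{i+j=m-1\\ i,j\geq 0}} \binom{p+i-1}{i}\binom{q+j-1}{j} (-1)^i \zeta(p+i)\widetilde{t}(q+j)-\sum_{\substack{i+j=q-1\\ i,j\geq 0}} \binom{m+i-1}{i}\binom{p+j-1}{j} \widetilde{t}(m+i)\widetilde{t}(p+j), \end{align*} where $\zeta(1)$ is to be interpreted as $-2\log(2)$ wherever it occurs, and $\widetilde t(1):=0$.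
   Context: $H_n^{(k)}=\sum_{l=1}^n l^{-k}$ with $H_0^{(k)}=0$. For $s>1$, $\widetilde t(s)=\sum_{n\ge1}(n-1/2)^{-s}=(2^s-1)\zeta(s)$; $\zeta$ is the Riemann zeta function. *)

(* Defs.v *)
(* Stdlib reals and Coquelicot series. *)
From Stdlib Require Import Reals.
From Coquelicot Require Import Coquelicot.
Open Scope R_scope.

(* Coquelicot's [C] is the type of complex numbers, hence the qualified name
   for the real-valued binomial coefficient. *)
Definition binom (n k : nat) : R := Stdlib.Reals.Binomial.C n k.

Definition harmonic (k n : nat) : R :=
  sum_n_m (fun l : nat => / (INR l ^ k)) 1 n.

(* In the series below the summation index n >= 1 is [S k], k >= 0. *)

Definition zeta_series (s : nat) : R :=
  Series (fun k : nat => / (INR (S k) ^ s)).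

(* Riemann zeta at positive integers, with the convention
   zeta(1) := - 2 log 2. *)
Definition zeta (s : nat) : R :=
  if Nat.eqb s 1 then - (2 * ln 2) else zeta_series s.

Definition t_series (s : nat) : R :=
  Series (fun k : nat => / ((INR (S k) - 1 / 2) ^ s)).

(* t~ at positive integers, with the convention t~(1) := 0. *)
Definition t_tilde (s : nat) : R :=
  if Nat.eqb s 1 then 0 else t_series s.

(* sum_{n >= 1} H_{n-1}^{(a)} / (n - 1/2)^b; with n = S k, H_{n-1} is H_k. *)
Definition harmonic_sum (a b : nat) : R :=
  Series (fun k : nat => harmonic a k / ((INR (S k) - 1 / 2) ^ b)).

(* sum of f i j over all i, j >= 0 with i + j = N *)
Definition sum_antidiag (N : nat) (f : nat -> nat -> R) : R :=
  sum_f_R0 (fun i : nat => f i (N - i)%nat) N.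

(* Main.v *)
(* With a_k = k - 1/2 and F_m(s) = sum_(k <= N) (a_k - s)^(-m), the rational
   function F_m(s) F_p(s) s^(-q) decays like s^(-2) at infinity, so its residues
   sum to zero; this stays true after subtracting sum_(k <= N) 1/a_k from F_1,
   because q > 1. The residue at 0 gives the products of truncated t~ values
   (with t~(1) = 0), and the residue at a_n gives 1/a_n^(m+p+q-1) together with
   sum_(l <= N, l <> n) 1/(l - n)^s, that is H_(N-n)^(s) + (-1)^s H_(n-1)^(s).
   As N grows, dominated convergence applies; the subtracted constant turns
   H_(N-n)^(1) into a sequence tending to - 2 log 2, the value prescribed for
   zeta(1). *)
Require Import Defs.
From Stdlib Require Import Reals Lra Lia.
From Coquelicot Require Import Coquelicot.
Open Scope R_scope.

(** * Finite sums and signs *)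

Lemma sum_f_R0_exchange (f : nat -> nat -> R) (M N : nat) :
  sum_f_R0 (fun i => sum_f_R0 (f i) N) M
  = sum_f_R0 (fun j => sum_f_R0 (fun i => f i j) M) N.
Proof.
  induction M as [|M IH]; simpl.
  - reflexivity.
  - rewrite IH, <- plus_sum. reflexivity.
Qed.

Lemma sum_f_R0_scal_l (x : R) (f : nat -> R) (N : nat) :
  sum_f_R0 (fun i => x * f i) N = x * sum_f_R0 f N.
Proof. rewrite scal_sum. apply sum_eq; intros; ring. Qed.

Lemma sum_f_R0_shift (f : nat -> R) (N : nat) :
  sum_f_R0 f (S N) = f 0%nat + sum_f_R0 (fun i => f (S i)) N.
Proof. rewrite decomp_sum by lia. reflexivity. Qed.

Lemma sum_f_R0_single (f : nat -> R) (k N : nat) :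
  (k <= N)%nat -> (forall i, i <> k -> f i = 0) -> sum_f_R0 f N = f k.
Proof.
  intros Hk Hf. induction N as [|N IH]; simpl.
  - now replace k with 0%nat by lia.
  - destruct (Nat.eq_dec k (S N)) as [->|Hne].
    + rewrite sum_eq_R0; [ring|]. intros i Hi. apply Hf. lia.
    + rewrite IH by lia. rewrite (Hf (S N)) by lia. ring.
Qed.

Lemma pow_m1_sqr (n : nat) : (-1) ^ n * (-1) ^ n = 1.
Proof. rewrite <- Rpow_mult_distr. replace (-1 * -1) with 1 by ring. apply pow1. Qed.

Lemma pow_opp (x : R) (n : nat) : (- x) ^ n = (-1) ^ n * x ^ n.
Proof. rewrite <- Rpow_mult_distr. f_equal. ring. Qed.

Lemma inv_pow_m1 (n : nat) : / (-1) ^ n = (-1) ^ n.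
Proof.
  assert (H := pow_m1_sqr n). apply Rmult_eq_reg_l with ((-1) ^ n).
  - rewrite H. field. apply pow_nonzero; lra.
  - apply pow_nonzero; lra.
Qed.

(** * Coefficients of products of negative powers *)

(* The case [m = 0] is separate because [binom (i - 1) i] is not [0] in Stdlib. *)
Definition mchoose (m i : nat) : R :=
  match m, i with
  | O, O => 1
  | O, S _ => 0
  | S m', _ => binom (m' + i) i
  end.

Lemma mchoose_binom (m i : nat) : (0 < m)%nat -> mchoose m i = binom (m + i - 1) i.
Proof. destruct m as [|m]; [lia|]. intros _. simpl. now rewrite Nat.sub_0_r. Qed.

Lemma mchoose_0_r (m : nat) : mchoose m 0 = 1.
Proof.
  destruct m as [|m]; [reflexivity|].
  unfold mchoose, binom, Binomial.C. rewrite Nat.add_0_r, Nat.sub_0_r. simpl.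
  field. apply INR_fact_neq_0.
Qed.

Lemma C_diag (n : nat) : Binomial.C n n = 1.
Proof.
  unfold Binomial.C. rewrite Nat.sub_diag. simpl (INR (Factorial.fact 0)).
  field. apply INR_fact_neq_0.
Qed.

(** Pascal's rule; the value [0] of [mchoose 0 (S i)] makes it hold at [m = 0] too. *)
Lemma mchoose_SS (m i : nat) :
  mchoose (S m) (S i) = mchoose (S m) i + mchoose m (S i).
Proof.
  destruct m as [|m]; unfold mchoose, binom.
  - simpl Nat.add. rewrite !C_diag. ring.
  - replace (S m + S i)%nat with (S (S m + i)) by lia.
    replace (m + S i)%nat with (S m + i)%nat by lia.
    rewrite <- pascal by lia. reflexivity.
Qed.

Lemma mchoose_sym (m i : nat) : mchoose (S m) i = mchoose (S i) m.
Proof.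
  unfold mchoose, binom. rewrite pascal_step1 by lia.
  rewrite (Nat.add_comm i m). f_equal. lia.
Qed.

(* Coefficient of [s^i] in [(x - s)^(-m)]. At [x = 0] it is [0] unless
   [m = i = 0]. *)
Definition coef (x : R) (m i : nat) : R := mchoose m i * / x ^ (m + i).

(* Coefficient of [s^(K - 1)] in [(x - s)^(-m) (y - s)^(-p)], i.e. the residue
   at [0] of [(x - s)^(-m) (y - s)^(-p) s^(-K)]. *)
Definition conv (x y : R) (m p K : nat) : R :=
  match K with
  | O => 0
  | S N => sum_antidiag N (fun i j => coef x m i * coef y p j)
  end.

Lemma coef_0_S (x : R) (i : nat) : coef x 0 (S i) = 0.
Proof. unfold coef; simpl; ring. Qed.

Lemma coef_0_0 (x : R) : coef x 0 0 = 1.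
Proof. unfold coef; simpl. field. Qed.

Lemma coef_S_0 (x : R) (m : nat) : x <> 0 -> x * coef x (S m) 0 = coef x m 0.
Proof.
  intros Hx. unfold coef. rewrite !mchoose_0_r, !Nat.add_0_r. simpl.
  field. split; [apply pow_nonzero|]; exact Hx.
Qed.

(** Compares coefficients of [s^(i+1)] in [(x - s) (x - s)^(-m-1) = (x - s)^(-m)]. *)
Lemma coef_S_S (x : R) (m i : nat) : x <> 0 ->
  x * coef x (S m) (S i) = coef x (S m) i + coef x m (S i).
Proof.
  intros Hx. unfold coef. rewrite mchoose_SS.
  replace (S m + S i)%nat with (S (S (m + i))) by lia.
  replace (S m + i)%nat with (S (m + i)) by lia.
  replace (m + S i)%nat with (S (m + i)) by lia.
  simpl. field. split; [apply pow_nonzero|]; exact Hx.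
Qed.

Lemma coef_opp (x : R) (m i : nat) : coef (- x) m i = (-1) ^ (m + i) * coef x m i.
Proof. unfold coef. rewrite pow_opp, Rinv_mult, inv_pow_m1. ring. Qed.

Lemma coef_sym (x : R) (m i : nat) : coef x (S m) i = coef x (S i) m.
Proof.
  unfold coef. rewrite mchoose_sym. now replace (S i + m)%nat with (S m + i)%nat by lia.
Qed.

Lemma conv_sym (x y : R) (m p K : nat) : conv x y m p K = conv y x p m K.
Proof.
  destruct K as [|N]; [reflexivity|]. unfold conv, sum_antidiag.
  rewrite <- sum_f_R0_skip. apply sum_eq. intros i Hi.
  replace (N - (N - i))%nat with i by lia. ring.
Qed.

Lemma conv_0_l (x y : R) (p N : nat) : conv x y 0 p (S N) = coef y p N.
Proof.
  unfold conv, sum_antidiag. rewrite (sum_f_R0_single _ 0); [|lia|].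
  - rewrite coef_0_0, Nat.sub_0_r. ring.
  - intros [|i] Hi; [lia|]. rewrite coef_0_S. ring.
Qed.

(** Multiplication by [x - s] lowers the exponent [m]. The value [conv x y m p 0 = 0] covers
    [K = 0]. *)
Lemma conv_S_l (x y : R) (m p K : nat) : x <> 0 ->
  x * conv x y (S m) p (S K) = conv x y (S m) p K + conv x y m p (S K).
Proof.
  intros Hx. destruct K as [|N]; unfold conv, sum_antidiag.
  - simpl sum_f_R0. rewrite <- (coef_S_0 x m) by exact Hx. ring.
  - rewrite !sum_f_R0_shift, Rmult_plus_distr_l, <- sum_f_R0_scal_l.
    rewrite <- (coef_S_0 x m) by exact Hx.
    rewrite Rplus_comm, (Rplus_comm (x * _ * _)), <- Rplus_assoc, <- plus_sum.
    f_equal; [|ring]. apply sum_eq. intros i Hi. simpl Nat.sub.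
    rewrite <- Rmult_assoc, coef_S_S by exact Hx. ring.
Qed.

(** Both sides satisfy the recursion given by multiplication by [x - s], which determines them since
    [x <> 0]. *)
Lemma conv_diag (x : R) (m p N : nat) : x <> 0 ->
  conv x x m p (S N) = coef x (m + p) N.
Proof.
  intros Hx. revert N. induction m as [|m IHm]; intros N.
  - apply conv_0_l.
  - apply Rmult_eq_reg_l with x; [|exact Hx].
    rewrite conv_S_l by exact Hx. rewrite IHm. simpl Nat.add.
    induction N as [|N IHN].
    + rewrite coef_S_0 by exact Hx. simpl. ring.
    + rewrite coef_S_S by exact Hx. f_equal.
      apply Rmult_eq_reg_l with x; [|exact Hx].
      rewrite conv_S_l by exact Hx. rewrite IHm. exact IHN.
Qed.

(** Writes [x - y] as [(x - s) - (y - s)]: in the difference of the two recursions the lower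
    coefficient cancels. *)
Lemma conv_sub (x y : R) (m p K : nat) : x <> 0 -> y <> 0 ->
  (x - y) * conv x y (S m) (S p) (S K)
  = conv x y m (S p) (S K) - conv x y (S m) p (S K).
Proof.
  intros Hx Hy. assert (H1 := conv_S_l x y m (S p) K Hx).
  assert (H2 := conv_S_l y x p (S m) K Hy).
  rewrite (conv_sym y x), (conv_sym y x), (conv_sym y x) in H2. lra.
Qed.

(* The residues of [(a - s)^(-m) (b - s)^(-p) s^(-q)] at [0], [a] and [b] sum
   to zero. The factor [a - b = (a - s) - (b - s)] lowers [m] or [p]. *)
Lemma residue_sum (a b : R) (m p q : nat) : a <> 0 -> b <> 0 -> a <> b ->
  (0 < m + p)%nat ->
  conv a b m p (S q)
  + (-1) ^ (m + S q) * conv (b - a) (- a) p (S q) m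
  + (-1) ^ (p + S q) * conv (a - b) (- b) m (S q) p = 0.
Proof.
  intros Ha Hb Hab.
  (* A single pole [x] besides [0]. In [u = s - x] the factor [s^(-K)] is [(-1)^K (-x - u)^(-K)],
     whence the argument [- x] and the sign; [coef_sym] makes the two residues opposite. *)
  assert (H0 : forall x y p, x <> 0 ->
    conv y x 0 (S p) (S q)
    + (-1) ^ (S p + S q) * conv (y - x) (- x) 0 (S q) (S p) = 0).
  { intros x y p' Hx. rewrite !conv_0_l, coef_opp, (coef_sym x q p').
    replace (S p' + S q)%nat with (S (S q + p')) by lia.
    assert (Hs := pow_m1_sqr (S q + p')). rewrite <- tech_pow_Rmult.
    transitivity (coef x (S p') q
      * (1 - (-1) ^ (S q + p') * (-1) ^ (S q + p'))); [ring|].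
    rewrite Hs. ring. }
  revert p. induction m as [|m IHm]; intros p.
  - destruct p as [|p]; [lia|]. intros _. simpl (conv (b - a) _ _ _ _).
    rewrite Rmult_0_r, Rplus_0_r. now apply H0.
  - intros _. induction p as [|p IHp].
    + simpl (conv (a - b) _ _ _ _).
      rewrite Rmult_0_r, Rplus_0_r, conv_sym. now apply H0.
    + assert (E1 := IHm (S p) ltac:(lia)).
      assert (K1 := conv_sub a b m p q Ha Hb).
      assert (K2 := conv_S_l (b - a) (- a) p (S q) m ltac:(lra)).
      assert (K3 := conv_S_l (a - b) (- b) m (S q) p ltac:(lra)).
      (* Times [a - b], the left side becomes the one for [(m, S p)] minus the one for [(S m, p)],
         that is [E1] minus [IHp]. *)
      apply Rmult_eq_reg_l with (a - b); [|lra].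
      rewrite Rmult_0_r, !Rmult_plus_distr_l, K1.
      replace ((a - b) * ((-1) ^ (S m + S q) * conv (b - a) (- a) (S p) (S q) (S m)))
        with (- (-1) ^ (S m + S q) * ((b - a) * conv (b - a) (- a) (S p) (S q) (S m)))
        by ring.
      replace ((a - b) * ((-1) ^ (S p + S q) * conv (a - b) (- b) (S m) (S q) (S p)))
        with ((-1) ^ (S p + S q) * ((a - b) * conv (a - b) (- b) (S m) (S q) (S p)))
        by ring.
      rewrite K2, K3.
      simpl Nat.add in *. simpl pow in *. lra.
Qed.

(** * The truncated identity *)

(** The pole [a_(k+1)]: indices start at [0], so a sum up to [N] runs over [N + 1] poles. *)
Definition node (k : nat) : R := INR (S k) - 1 / 2.

Definition node_sum (N s : nat) : R := sum_f_R0 (fun k => / node k ^ s) N.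

(* Constant subtracted at exponent [1] from every truncated sum: it makes the
   truncations of [t~(1)] vanish and those of [zeta(1)] converge. *)
Definition cutoff (N s : nat) : R := if Nat.eqb s 1 then node_sum N 1 else 0.

(* The term [l = n] is [0], as [/ 0 = 0]. *)
Definition gap_sum (N n s : nat) : R :=
  sum_f_R0 (fun l => / (node l - node n) ^ s) N - cutoff N s.

(* Minus the sum over [n <= N] of the residues at [node n] of the terms with a
   pole of order [m] at [node n] and one of order [p] at another node. *)
Definition cross_sum (N m p q : nat) : R :=
  sum_f_R0 (fun n => sum_antidiag (m - 1) (fun i j =>
    (-1) ^ i * mchoose p i * mchoose q j * gap_sum N n (p + i)
    * / node n ^ (q + j))) N.

Lemma node_pos (k : nat) : 0 < node k.
Proof. unfold node. rewrite S_INR. assert (H := pos_INR k). lra. Qed.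

Lemma node_neq_0 (k : nat) : node k <> 0.
Proof. assert (H := node_pos k). lra. Qed.

Lemma node_sub (k l : nat) : node k - node l = INR k - INR l.
Proof. unfold node. rewrite !S_INR. ring. Qed.

Lemma node_inj (k l : nat) : k <> l -> node k <> node l.
Proof.
  intros H E. apply H, INR_eq. assert (E' := node_sub k l). lra.
Qed.

(** Rests on [/ 0 = 0]; it removes the diagonal terms, where two nodes coincide. *)
Lemma conv_zero_l (y : R) (m p K : nat) : conv 0 y (S m) p K = 0.
Proof.
  destruct K as [|N]; [reflexivity|]. unfold conv, sum_antidiag.
  apply sum_eq_R0. intros i _. unfold coef. simpl.
  rewrite Rmult_0_l, Rinv_0. ring.
Qed.

(** Off the diagonal this is [residue_sum] solved for the residue at [0]. On it the two poles merge
    into one of order [S m + S p], and the other two terms vanish. *)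
Lemma conv_node (k l m p q : nat) :
  conv (node k) (node l) (S m) (S p) (S q)
  = (if Nat.eqb k l then coef (node k) (S m + S p) q else 0)
    - (-1) ^ (S m + S q) * conv (node l - node k) (- node k) (S p) (S q) (S m)
    - (-1) ^ (S p + S q) * conv (node k - node l) (- node l) (S m) (S q) (S p).
Proof.
  destruct (Nat.eqb_spec k l) as [<-|Hkl].
  - rewrite conv_diag by apply node_neq_0.
    rewrite Rminus_diag, !conv_zero_l. ring.
  - assert (H := residue_sum (node k) (node l) (S m) (S p) q (node_neq_0 k)
      (node_neq_0 l) (node_inj k l Hkl) ltac:(lia)). lra.
Qed.

Lemma sum_conv (x y : nat -> R) (m p K N : nat) :
  sum_f_R0 (fun k => sum_f_R0 (fun l => conv (x k) (y l) m p (S K)) N) N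
  = sum_antidiag K (fun i j =>
      sum_f_R0 (fun k => coef (x k) m i) N * sum_f_R0 (fun l => coef (y l) p j) N).
Proof.
  unfold conv, sum_antidiag.
  rewrite (sum_eq _ (fun k => sum_f_R0 (fun i => coef (x k) m i *
    sum_f_R0 (fun l => coef (y l) p (K - i)) N) K)).
  - rewrite sum_f_R0_exchange. apply sum_eq. intros i _.
    rewrite Rmult_comm, scal_sum. reflexivity.
  - intros k _. rewrite sum_f_R0_exchange. apply sum_eq. intros i _.
    apply sum_f_R0_scal_l.
Qed.

Lemma cutoff_SS (N m i : nat) : cutoff N (S m + S i) = 0.
Proof. unfold cutoff. replace (S m + S i)%nat with (S (S (m + i))) by lia. reflexivity. Qed.

(** The exponent [S m + i] can be [1] only at [i = 0]. *)
Lemma sum_cutoff (N m K : nat) (f : nat -> R) :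
  sum_f_R0 (fun i => cutoff N (S m + i) * f i) K = cutoff N (S m) * f 0%nat.
Proof.
  rewrite (sum_f_R0_single _ 0); [|lia|].
  - now rewrite Nat.add_0_r.
  - intros [|i] Hi; [lia|]. rewrite cutoff_SS. ring.
Qed.

Lemma mchoose_cutoff (N m i : nat) : mchoose (S m) i * cutoff N (S m + i) = cutoff N (S m + i).
Proof. destruct i; [rewrite mchoose_0_r; ring | rewrite cutoff_SS; ring]. Qed.

Lemma sum_coef (x : nat -> R) (m i N : nat) :
  sum_f_R0 (fun k => coef (x k) m i) N
  = mchoose m i * sum_f_R0 (fun k => / x k ^ (m + i)) N.
Proof. apply sum_f_R0_scal_l. Qed.

(** Expands the product of the two corrected sums; only the term with both cutoffs disappears. *)
Lemma residue_at_0 (N m p q : nat) :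
  sum_antidiag (S q) (fun i j => mchoose (S m) i * mchoose (S p) j
    * (node_sum N (S m + i) - cutoff N (S m + i))
    * (node_sum N (S p + j) - cutoff N (S p + j)))
  = sum_f_R0 (fun k => sum_f_R0 (fun l =>
      conv (node k) (node l) (S m) (S p) (S (S q))) N) N
    - cutoff N (S m) * sum_f_R0 (fun l => coef (node l) (S p) (S q)) N
    - cutoff N (S p) * sum_f_R0 (fun k => coef (node k) (S m) (S q)) N.
Proof.
  rewrite sum_conv.
  assert (C1 := sum_cutoff N m (S q)
    (fun i => sum_f_R0 (fun l => coef (node l) (S p) (S q - i)) N)).
  assert (C2 := sum_cutoff N p (S q)
    (fun j => sum_f_R0 (fun k => coef (node k) (S m) (S q - j)) N)).
  cbv beta in C1, C2. rewrite Nat.sub_0_r in C1, C2. rewrite <- C1, <- C2.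
  rewrite <- (sum_f_R0_skip (fun i => cutoff N (S p + i) * _)).
  unfold sum_antidiag. rewrite <- !minus_sum. apply sum_eq. intros i Hi.
  replace (S q - (S q - i))%nat with i by lia.
  rewrite !sum_coef. fold (node_sum N (S m + i)) (node_sum N (S p + (S q - i))).
  assert (E1 := mchoose_cutoff N m i). assert (E2 := mchoose_cutoff N p (S q - i)).
  (* Two nonzero cutoffs would need [i = 0] and [S q - i = 0] at once. Here the exponent of [1/s],
     which is [S (S q)], has to exceed [1]. *)
  assert (E3 : cutoff N (S m + i) * cutoff N (S p + (S q - i)) = 0).
  { destruct i as [|i]; [rewrite Nat.sub_0_r, (cutoff_SS N p q)|rewrite cutoff_SS]; ring. }
  set (u := mchoose (S m) i) in *. set (v := mchoose (S p) (S q - i)) in *.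
  set (c := cutoff N (S m + i)) in *. set (d := cutoff N (S p + (S q - i))) in *.
  set (A := node_sum N (S m + i)). set (B := node_sum N _).
  transitivity (u * A * (v * B) - (u * c) * (v * B) - (v * d) * (u * A)
    + (u * v) * (c * d)); [ring|].
  rewrite E1, E2, E3. ring.
Qed.

(** The inner [conv] is the expansion at [node n]; summing it over [l] gives the gap sums before the
    cutoff is subtracted. The cutoff enters at [i = 0] only and leaves a multiple of
    [coef (node n) (S m) q]. *)
Lemma cross_sum_conv (N m p q : nat) :
  cross_sum N (S m) (S p) (S q)
  = - (-1) ^ (S m + S q) * sum_f_R0 (fun n => sum_f_R0 (fun l =>
        conv (node l - node n) (- node n) (S p) (S q) (S m)) N) N
    - cutoff N (S p) * sum_f_R0 (fun n => coef (node n) (S m) q) N.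
Proof.
  unfold cross_sum. rewrite <- !sum_f_R0_scal_l, <- minus_sum.
  apply sum_eq. intros n _. rewrite (coef_sym (node n) m q).
  unfold conv, sum_antidiag. rewrite sum_f_R0_exchange.
  replace (S m - 1)%nat with m by lia.
  assert (C1 := sum_cutoff N p m (fun i => coef (node n) (S q) (m - i))).
  cbv beta in C1. rewrite Nat.sub_0_r in C1. rewrite <- C1.
  rewrite <- sum_f_R0_scal_l, <- minus_sum. apply sum_eq. intros i Hi.
  rewrite (sum_eq _ (fun l => coef (- node n) (S q) (m - i) * coef (node l - node n) (S p) i))
    by (intros; ring).
  rewrite sum_f_R0_scal_l, sum_coef, coef_opp.
  (* The exponents add up to [i + 1] plus an even number. *)
  assert (Es : (-1) ^ (S m + S q) * (-1) ^ (S q + (m - i)) = - (-1) ^ i).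
  { rewrite <- pow_add.
    replace (S m + S q + (S q + (m - i)))%nat
      with (S (i + 2 * (m - i + S q))) by lia.
    rewrite <- tech_pow_Rmult, pow_add, pow_1_even. ring. }
  unfold gap_sum. set (Z := sum_f_R0 _ N).
  assert (E1 := mchoose_cutoff N p i).
  assert (E2 : (-1) ^ i * cutoff N (S p + i) = cutoff N (S p + i)).
  { destruct i; [simpl; ring|rewrite cutoff_SS; ring]. }
  unfold coef at 1 2. set (u := mchoose (S p) i) in *.
  set (v := mchoose (S q) (m - i)). set (c := cutoff N (S p + i)) in *.
  set (w := / _). transitivity ((-1) ^ i * (u * Z * v * w) - (-1) ^ i * (u * c) * v * w); [ring|].
  rewrite E1, E2. 
  transitivity (- ((-1) ^ (S m + S q) * (-1) ^ (S q + (m - i))) * (u * Z * v * w) - c * (v * w));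
  [rewrite Es|]; ring.
Qed.

(** Sums [conv_node] over all pairs of nodes. The cutoff terms produced by [residue_at_0] and by the
    two [cross_sum_conv] are the same and cancel. *)
Lemma truncated_identity (N m p q : nat) :
  sum_antidiag (S q) (fun i j => mchoose (S m) i * mchoose (S p) j
    * (node_sum N (S m + i) - cutoff N (S m + i))
    * (node_sum N (S p + j) - cutoff N (S p + j)))
  = mchoose (S m + S p) (S q) * node_sum N (S m + S p + S q)
    + cross_sum N (S m) (S p) (S (S q)) + cross_sum N (S p) (S m) (S (S q)).
Proof.
  rewrite residue_at_0, !cross_sum_conv.
  (* In the second cross sum the distinguished pole is the second index of the pair. *)
  rewrite (sum_f_R0_exchange (fun n l => conv (node l - node n) (- node n) (S m) (S (S q)) (S p))).
  assert (E : sum_f_R0 (fun k => sum_f_R0 (fun l =>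
      conv (node k) (node l) (S m) (S p) (S (S q))) N) N
    = sum_f_R0 (fun k => coef (node k) (S m + S p) (S q)) N
      - (-1) ^ (S m + S (S q)) * sum_f_R0 (fun k => sum_f_R0 (fun l =>
        conv (node l - node k) (- node k) (S p) (S (S q)) (S m)) N) N
      - (-1) ^ (S p + S (S q)) * sum_f_R0 (fun k => sum_f_R0 (fun l =>
        conv (node k - node l) (- node l) (S m) (S (S q)) (S p)) N) N).
  { rewrite <- !sum_f_R0_scal_l, <- !minus_sum. apply sum_eq. intros k Hk.
    rewrite <- !sum_f_R0_scal_l.
    (* The diagonal residue is spread over [l] so that [conv_node] applies termwise. *)
    replace (coef (node k) (S m + S p) (S q)) with
      (sum_f_R0 (fun l => if Nat.eqb k l then coef (node k) (S m + S p) (S q) else 0) N).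
    - rewrite <- !minus_sum. apply sum_eq. intros l _. apply conv_node.
    - rewrite (sum_f_R0_single _ k); [now rewrite Nat.eqb_refl|exact Hk|].
      intros l Hl. destruct (Nat.eqb_spec k l); [congruence|reflexivity]. }
  rewrite E, (sum_coef node (S m + S p)).
  fold (node_sum N (S m + S p + S q)). ring.
Qed.

(** * Gap sums in terms of harmonic numbers *)

Lemma harmonic_S (s n : nat) : harmonic s (S n) = harmonic s n + / INR (S n) ^ s.
Proof. unfold harmonic. rewrite sum_n_Sm by lia. reflexivity. Qed.

Lemma harmonic_0 (s : nat) : harmonic s 0 = 0.
Proof. unfold harmonic. rewrite sum_n_m_zero by lia. reflexivity. Qed.

(** The extra term [l = 0] is [/ 0 ^ s = / 0 = 0] because [s > 0]. *)
Lemma harmonic_sum_f_R0 (s n : nat) : (0 < s)%nat ->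
  harmonic s n = sum_f_R0 (fun l => / INR l ^ s) n.
Proof.
  intros Hs. induction n as [|n IH].
  - rewrite harmonic_0. simpl sum_f_R0. rewrite pow_i by exact Hs.
    now rewrite Rinv_0.
  - rewrite harmonic_S, IH. reflexivity.
Qed.

Lemma harmonic_sum_f_R0_S (s n : nat) :
  harmonic s (S n) = sum_f_R0 (fun l => / INR (S l) ^ s) n.
Proof.
  induction n as [|n IH].
  - rewrite harmonic_S, harmonic_0. apply Rplus_0_l.
  - rewrite harmonic_S, IH. reflexivity.
Qed.

(** Nodes to the right of [node n] lie at distances [1, ..., N - n], those to the left at
    [1, ..., n] with a negative difference. *)
Lemma gap_sum_harmonic (N n s : nat) : (0 < s)%nat -> (n <= N)%nat ->
  gap_sum N n s = harmonic s (N - n) - cutoff N s + (-1) ^ s * harmonic s n.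
Proof.
  intros Hs Hn. unfold gap_sum.
  cut (forall d, sum_f_R0 (fun l => / (node l - node n) ^ s) (n + d)
    = harmonic s d + (-1) ^ s * harmonic s n).
  { intros H. specialize (H (N - n)%nat).
    replace (n + (N - n))%nat with N in H by lia. rewrite H. ring. }
  induction d as [|d IH].
  - rewrite Nat.add_0_r, harmonic_0, Rplus_0_l.
    rewrite harmonic_sum_f_R0, <- sum_f_R0_skip, <- sum_f_R0_scal_l by exact Hs.
    apply sum_eq. intros i Hi. rewrite node_sub, minus_INR by exact Hi.
    replace (INR n - INR i - INR n) with (- INR i) by ring.
    now rewrite pow_opp, Rinv_mult, inv_pow_m1.
  - rewrite Nat.add_succ_r. simpl sum_f_R0. rewrite IH, harmonic_S, node_sub.
    replace (S (n + d)) with (n + S d)%nat by lia. rewrite plus_INR.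
    replace (INR n + INR (S d) - INR n) with (INR (S d)) by ring. ring.
Qed.

(** * Convergence *)

Lemma is_lim_seq_sum_f_R0 (f : nat -> nat -> R) (l : nat -> R) (K : nat) :
  (forall i, (i <= K)%nat -> is_lim_seq (fun N => f N i) (l i)) ->
  is_lim_seq (fun N => sum_f_R0 (f N) K) (sum_f_R0 l K).
Proof.
  induction K as [|K IH]; intros H; simpl.
  - apply H. lia.
  - apply is_lim_seq_plus'; [apply IH; intros i Hi|]; apply H; lia.
Qed.

Lemma is_lim_seq_Series (f : nat -> R) : ex_series f ->
  is_lim_seq (sum_f_R0 f) (Series f).
Proof.
  intros H. apply is_lim_seq_ext with (sum_n f); [apply sum_n_Reals|].
  exact (Series_correct f H).
Qed.

Lemma sum_f_R0_le_Series (f : nat -> R) (N : nat) :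
  (forall k, 0 <= f k) -> ex_series f -> sum_f_R0 f N <= Series f.
Proof.
  intros Hf Hex. apply (is_lim_seq_incr_compare (sum_f_R0 f)).
  - now apply is_lim_seq_Series.
  - intros n. simpl. specialize (Hf (S n)). lra.
Qed.

Lemma ex_series_nonneg_bounded (f : nat -> R) (M : R) :
  (forall k, 0 <= f k) -> (forall N, sum_f_R0 f N <= M) -> ex_series f.
Proof.
  intros Hf HM. destruct (ex_finite_lim_seq_incr (sum_f_R0 f) M) as [l Hl].
  - intros n. simpl. specialize (Hf (S n)). lra.
  - exact HM.
  - exists l. apply is_lim_seq_ext with (v := sum_n f) in Hl; [exact Hl|].
    intros n. symmetry. apply sum_n_Reals.
Qed.

Lemma ex_series_Rabs_le (a b : nat -> R) :
  (forall n, Rabs (a n) <= b n) -> ex_series b -> ex_series a.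
Proof. exact (@ex_series_le R_AbsRing R_CompleteNormedModule a b). Qed.

(** Dominated convergence for a triangular array: finitely many first terms converge, and the rest
    differ from their limits by at most twice a tail of [g]. *)
Lemma tannery (f : nat -> nat -> R) (g l : nat -> R) :
  (forall N n, (n <= N)%nat -> Rabs (f N n) <= g n) ->
  ex_series g ->
  (forall n, is_lim_seq (fun N => f N n) (l n)) ->
  is_lim_seq (fun N => sum_f_R0 (f N) N) (Series l).
Proof.
  intros Hfg Hg Hl.
  (* The bound on [f N n] holds once [N >= n], hence passes to the limit and makes [l] summable. *)
  assert (Hlg : forall n, Rabs (l n) <= g n).
  { intros n.
    apply (is_lim_seq_le_loc (fun N => Rabs (f N n)) (fun _ => g n)
             (Rabs (l n)) (g n)).
    - exists n. intros N HN. now apply Hfg.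
    - exact (is_lim_seq_abs _ _ (Hl n)).
    - apply is_lim_seq_const. }
  assert (Hgs := is_lim_seq_Series g Hg).
  assert (Hls : ex_series l) by exact (ex_series_Rabs_le l g Hlg Hg).
  apply is_lim_seq_ext with
    (fun N => sum_f_R0 (fun n => f N n - l n) N + sum_f_R0 l N).
  { intros N. rewrite minus_sum. ring. }
  replace (Series l) with (0 + Series l) by ring.
  apply is_lim_seq_plus'; [|now apply is_lim_seq_Series].
  apply is_lim_seq_spec. intros eps.
  (* Two partial sums of [g] within [eps / 8] of the limit leave a tail below [eps / 4], counted
     twice; with [eps / 8] for the head the total is below [eps]. *)
  assert (He : 0 < eps / 8) by (assert (H := cond_pos eps); lra).
  destruct (proj2 (is_lim_seq_spec _ _) Hgs (mkposreal _ He)) as [K HK].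
  assert (Hfin : is_lim_seq (fun N => sum_f_R0 (fun n => Rabs (f N n - l n)) K) 0).
  { replace 0 with (sum_f_R0 (fun _ => 0) K) by (apply sum_eq_R0; reflexivity).
    apply is_lim_seq_sum_f_R0. intros i _.
    rewrite <- Rabs_R0. apply (is_lim_seq_abs _ 0).
    replace 0 with (l i - l i) by ring.
    apply is_lim_seq_minus'; [apply Hl|apply is_lim_seq_const]. }
  destruct (proj2 (is_lim_seq_spec _ _) Hfin (mkposreal _ He)) as [K' HK'].
  exists (Nat.max (S K) K'). intros N HN.
  assert (HKK := HK K (le_n _)). assert (HKN := HK N ltac:(lia)).
  specialize (HK' N ltac:(lia)). simpl in HKK, HKN, HK'.
  rewrite Rminus_0_r in HK' |- *.
  apply Rabs_def2 in HKK. apply Rabs_def2 in HKN. apply Rabs_def2 in HK'.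
  apply Rle_lt_trans with (sum_f_R0 (fun n => Rabs (f N n - l n)) N).
  { apply Rsum_abs. }
  rewrite (tech2 _ K N) by lia. rewrite (tech2 g K N) in HKN by lia.
  assert (Ht : sum_f_R0 (fun i => Rabs (f N (S K + i)%nat - l (S K + i)%nat)) (N - S K)
     <= 2 * sum_f_R0 (fun i => g (S K + i)%nat) (N - S K)).
  { rewrite <- sum_f_R0_scal_l. apply sum_Rle. intros i Hi.
    assert (H1 := Hfg N (S K + i)%nat ltac:(lia)).
    assert (H2 := Hlg (S K + i)%nat).
    assert (H3 := Rabs_triang (f N (S K + i)%nat) (- l (S K + i)%nat)).
    rewrite Rabs_Ropp in H3. unfold Rminus. lra. }
  lra.
Qed.

(** * Majorants and summability *)

Lemma harmonic_ge_0 (s n : nat) : 0 <= harmonic s n.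
Proof.
  induction n as [|n IH]; [rewrite harmonic_0; lra|]. rewrite harmonic_S.
  assert (0 < / INR (S n) ^ s); [|lra].
  apply Rinv_0_lt_compat, pow_lt, lt_0_INR. lia.
Qed.

Lemma harmonic_le_1 (s n : nat) : (0 < s)%nat -> harmonic s n <= harmonic 1 n.
Proof.
  intros Hs. induction n as [|n IH]; [rewrite !harmonic_0; lra|].
  rewrite !harmonic_S. apply Rplus_le_compat; [exact IH|].
  assert (1 <= INR (S n)) by (rewrite S_INR; assert (H := pos_INR n); lra).
  apply Rinv_le_contravar; [apply pow_lt; lra|]. apply Rle_pow; [assumption|lia].
Qed.

Lemma inv_node_pow_pos (k s : nat) : 0 < / node k ^ s.
Proof. apply Rinv_0_lt_compat, pow_lt, node_pos. Qed.

(* Telescopes [(h_k + 1) / ((k + 1) (k + 2)) = u_k - u_(k+1)] with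
   [u_k = (h_k + 2) / (k + 1)]. *)
Lemma ex_series_harmonic_node (s : nat) : (1 < s)%nat ->
  ex_series (fun k => (harmonic 1 k + 1) * / node k ^ s).
Proof.
  intros Hs.
  (* [2 ^ (s - 2)] comes from [node k >= 1/2], the [8] from [(k + 1) (k + 2) <= 8 (k + 1/2)^2], and
     the last [2] is [u_0], which bounds the telescoped sum. *)
  apply ex_series_nonneg_bounded with (2 ^ (s - 2) * 8 * 2).
  { intros k. assert (H1 := harmonic_ge_0 1 k).
    assert (H2 := inv_node_pow_pos k s). apply Rmult_le_pos; lra. }
  intros N.
  assert (HT : sum_f_R0 (fun k => (harmonic 1 k + 1) / ((INR k + 1) * (INR k + 2))) N
     = 2 - (harmonic 1 (S N) + 2) / (INR N + 2)).
  { induction N as [|N IH].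
    - unfold sum_f_R0. rewrite harmonic_S, harmonic_0. simpl. field.
    - rewrite tech5, IH, (harmonic_S 1 (S N)), !S_INR.
      assert (H := pos_INR N). simpl pow. field. lra. }
  apply Rle_trans with (2 ^ (s - 2) * 8 *
    sum_f_R0 (fun k => (harmonic 1 k + 1) / ((INR k + 1) * (INR k + 2))) N).
  - rewrite <- sum_f_R0_scal_l. apply sum_Rle. intros k _.
    assert (Hk := pos_INR k). assert (Hh := harmonic_ge_0 1 k).
    replace s with (s - 2 + 2)%nat at 1 by lia. rewrite pow_add, Rinv_mult.
    assert (B1 : / node k ^ (s - 2) <= 2 ^ (s - 2)).
    { rewrite <- pow_inv. apply pow_incr. split.
      - left. apply Rinv_0_lt_compat, node_pos.
      - replace 2 with (/ (1 / 2)) by field. apply Rinv_le_contravar; [lra|].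
        unfold node. rewrite S_INR. lra. }
    assert (B2 : / node k ^ 2 <= 8 * / ((INR k + 1) * (INR k + 2))).
    { unfold node. rewrite S_INR.
      replace (8 * / ((INR k + 1) * (INR k + 2)))
        with (/ ((INR k + 1) * (INR k + 2) / 8)) by (field; lra).
      apply Rinv_le_contravar; nra. }
    assert (P1 := inv_node_pow_pos k (s - 2)). assert (P2 := inv_node_pow_pos k 2).
    unfold Rdiv.
    apply Rle_trans with ((harmonic 1 k + 1) *
      (2 ^ (s - 2) * (8 * / ((INR k + 1) * (INR k + 2))))); [|right; ring].
    apply Rmult_le_compat_l; [lra|]. apply Rmult_le_compat; lra.
  - apply Rmult_le_compat_l.
    + assert (0 < 2 ^ (s - 2)) by (apply pow_lt; lra). lra.
    + rewrite HT. assert (Hk := pos_INR N). assert (Hh := harmonic_ge_0 1 (S N)).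
      assert (0 < (harmonic 1 (S N) + 2) / (INR N + 2)); [|lra].
      apply Rdiv_lt_0_compat; lra.
Qed.

Lemma ex_series_harmonic_sum (a b : nat) : (0 < a)%nat -> (1 < b)%nat ->
  ex_series (fun k => harmonic a k / node k ^ b).
Proof.
  intros Ha Hb.
  apply (ex_series_Rabs_le _ (fun k => (harmonic 1 k + 1) * / node k ^ b));
    [|now apply ex_series_harmonic_node].
  intros k.
  assert (H1 := harmonic_ge_0 a k). assert (H2 := harmonic_le_1 a k Ha).
  assert (H3 := inv_node_pow_pos k b).
  rewrite Rabs_right.
  - apply Rmult_le_compat_r; lra.
  - apply Rle_ge, Rmult_le_pos; lra.
Qed.

Lemma ex_series_node (s : nat) : (1 < s)%nat -> ex_series (fun k => / node k ^ s).
Proof.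
  intros Hs.
  apply (ex_series_Rabs_le _ (fun k => (harmonic 1 k + 1) * / node k ^ s));
    [|now apply ex_series_harmonic_node].
  intros k.
  assert (H1 := harmonic_ge_0 1 k). assert (H3 := inv_node_pow_pos k s).
  rewrite Rabs_right by lra. nra.
Qed.

Lemma ex_series_zeta (s : nat) : (1 < s)%nat -> ex_series (fun k => / INR (S k) ^ s).
Proof.
  intros Hs.
  apply (ex_series_Rabs_le _ (fun k => / node k ^ s)); [|now apply ex_series_node].
  intros k.
  assert (0 < INR (S k)) by (apply lt_0_INR; lia).
  rewrite Rabs_right.
  - apply Rinv_le_contravar; [apply pow_lt, node_pos|].
    apply pow_incr. assert (H1 := node_pos k). unfold node in *. lra.
  - apply Rle_ge, Rlt_le, Rinv_0_lt_compat, pow_lt. assumption.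
Qed.

(** At [s = 1] the sequence is identically [0], in accordance with the convention for [t~(1)]. *)
Lemma node_sum_cutoff_lim (s : nat) :
  (0 < s)%nat -> is_lim_seq (fun N => node_sum N s - cutoff N s) (t_tilde s).
Proof.
  intros Hs. unfold cutoff, t_tilde. destruct (Nat.eqb_spec s 1) as [->|Hne].
  - apply is_lim_seq_ext with (fun _ => 0); [intros; ring|apply is_lim_seq_const].
  - apply is_lim_seq_ext with (fun N => node_sum N s); [intros; ring|].
    apply is_lim_seq_Series, ex_series_node. lia.
Qed.

(** * Harmonic numbers against node sums: the origin of [- 2 log 2] *)

Lemma ln_succ_sub_le (x : R) : 0 < x -> ln (x + 1) - ln x <= / x.
Proof.
  intros Hx. assert (Hq : 0 < (x + 1) / x) by (apply Rdiv_lt_0_compat; lra).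
  assert (H := exp_ineq1_le (ln ((x + 1) / x))). rewrite exp_ln in H by exact Hq.
  rewrite ln_div in H by lra.
  replace ((x + 1) / x) with (1 + / x) in H by (field; lra). lra.
Qed.

Lemma ln_succ_sub_ge (x : R) : 0 < x -> / (x + 1) <= ln (x + 1) - ln x.
Proof.
  intros Hx. assert (Hq : 0 < x / (x + 1)) by (apply Rdiv_lt_0_compat; lra).
  assert (H := exp_ineq1_le (ln (x / (x + 1)))). rewrite exp_ln in H by exact Hq.
  rewrite ln_div in H by lra.
  replace (x / (x + 1)) with (1 - / (x + 1)) in H by (field; lra). lra.
Qed.

Lemma harmonic_sub_bounds (M j : nat) : (0 < M)%nat ->
  ln (INR (M + j) + 1) - ln (INR M + 1) <= harmonic 1 (M + j) - harmonic 1 M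
  <= ln (INR (M + j)) - ln (INR M).
Proof.
  intros HM. induction j as [|j IH].
  - rewrite Nat.add_0_r. lra.
  - rewrite Nat.add_succ_r, harmonic_S, S_INR. simpl pow. rewrite Rmult_1_r.
    assert (Hp : 0 < INR (M + j)) by (apply lt_0_INR; lia).
    assert (H1 := ln_succ_sub_le (INR (M + j) + 1) ltac:(lra)).
    assert (H2 := ln_succ_sub_ge (INR (M + j)) Hp). lra.
Qed.

(** As [1 / (k - 1/2) = 2 / (2k - 1)], this is twice the odd-denominator part of [H_(2n)], with
    [n = S N]; the even part is [H_n / 2]. *)
Lemma node_sum_1_harmonic (N : nat) :
  node_sum N 1 = 2 * harmonic 1 (S N + S N) - harmonic 1 (S N).
Proof.
  induction N as [|N IH].
  - unfold node_sum, node. simpl sum_f_R0. simpl Nat.add.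
    rewrite !harmonic_S, harmonic_0. simpl. field.
  - change (node_sum (S N) 1) with (node_sum N 1 + / node (S N) ^ 1). rewrite IH.
    replace (S (S N) + S (S N))%nat with (S (S (S N + S N))) by lia.
    rewrite (harmonic_S 1 (S (S N + S N))), (harmonic_S 1 (S N + S N)), (harmonic_S 1 (S N)).
    unfold node. rewrite !S_INR, plus_INR, !S_INR. simpl pow.
    assert (H := pos_INR N). field. lra.
Qed.

(** The difference equals [- 2 (H_(2n) - H_n)] with [n = S N], and [H_(2n) - H_n] is squeezed
    between logarithms. *)
Lemma harmonic_node_sum_bounds (N : nat) :
  - (2 * ln 2) <= harmonic 1 (S N) - node_sum N 1 <= - (2 * ln 2) + / INR (S N).
Proof.
  rewrite node_sum_1_harmonic.
  assert (H := harmonic_sub_bounds (S N) (S N) ltac:(lia)).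
  assert (Hp : 0 < INR (S N)) by (apply lt_0_INR; lia).
  rewrite plus_INR in H. set (x := INR (S N)) in *.
  assert (E1 : ln (x + x) = ln 2 + ln x).
  { rewrite <- ln_mult by lra. f_equal. ring. }
  assert (E2 : ln (x + x + 1 + 1) = ln 2 + ln (x + 1)).
  { rewrite <- ln_mult by lra. f_equal. ring. }
  (* Replaces [ln (2x + 1)] by [ln (2x + 2)] at a cost of at most [1 / (2x)], which doubles to the
     error [/ x]. *)
  assert (H1 := ln_succ_sub_le (x + x + 1) ltac:(lra)).
  assert (H2 : / (x + x + 1) <= / (2 * x)) by (apply Rinv_le_contravar; lra).
  rewrite Rinv_mult in H2. lra.
Qed.

Lemma is_lim_seq_inv_S : is_lim_seq (fun N => / INR (S N)) 0.
Proof.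
  apply (is_lim_seq_incr_1 (fun N => / INR N)).
  replace (Finite 0) with (Rbar_inv p_infty) by reflexivity.
  apply is_lim_seq_inv; [apply is_lim_seq_INR|discriminate].
Qed.

Lemma harmonic_node_sum_lim :
  is_lim_seq (fun N => harmonic 1 (S N) - node_sum N 1) (- (2 * ln 2)).
Proof.
  apply is_lim_seq_le_le with (fun _ => - (2 * ln 2))
    (fun N => - (2 * ln 2) + / INR (S N)).
  - apply harmonic_node_sum_bounds.
  - apply is_lim_seq_const.
  - replace (Finite (- (2 * ln 2))) with (Finite (- (2 * ln 2) + 0)) by (f_equal; ring).
    apply is_lim_seq_plus'; [apply is_lim_seq_const|apply is_lim_seq_inv_S].
Qed.

Lemma harmonic_shift_lim (d : nat) :
  is_lim_seq (fun M => harmonic 1 (M + d) - harmonic 1 M) 0.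
Proof.
  induction d as [|d IH].
  - apply is_lim_seq_ext with (fun _ => 0); [|apply is_lim_seq_const].
    intros M. rewrite Nat.add_0_r. ring.
  - apply is_lim_seq_ext with
      (fun M => harmonic 1 (M + d) - harmonic 1 M + / INR (S (M + d))).
    + intros M. rewrite Nat.add_succ_r, harmonic_S, pow_1. ring.
    + replace (Finite 0) with (Finite (0 + 0)) by (f_equal; ring).
      apply is_lim_seq_plus'; [exact IH|].
      apply (is_lim_seq_incr_n (fun M => / INR (S M)) d), is_lim_seq_inv_S.
Qed.

Lemma harmonic_cutoff_lim (s n : nat) : (0 < s)%nat ->
  is_lim_seq (fun N => harmonic s (N - n) - cutoff N s) (zeta s).
Proof.
  intros Hs. apply (is_lim_seq_incr_n _ n).
  apply is_lim_seq_ext with (fun M => harmonic s M - cutoff (M + n) s).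
  { intros M. now rewrite Nat.add_sub. }
  unfold cutoff, zeta. destruct (Nat.eqb_spec s 1) as [->|Hne].
  (* [harmonic 1 M] is compared with [harmonic 1 (S (M + n))], which has as many terms as
     [node_sum (M + n) 1]; the fixed shift by [S n] costs nothing in the limit. *)
  - apply is_lim_seq_ext with (fun M => (harmonic 1 (S (M + n)) - node_sum (M + n) 1)
      - (harmonic 1 (M + S n) - harmonic 1 M)).
    { intros M. rewrite Nat.add_succ_r. ring. }
    replace (Finite (- (2 * ln 2))) with (Finite (- (2 * ln 2) - 0)) by (f_equal; ring).
    apply is_lim_seq_minus'; [|apply harmonic_shift_lim].
    apply (is_lim_seq_incr_n (fun M => harmonic 1 (S M) - node_sum M 1) n).
    apply harmonic_node_sum_lim.
  - apply (is_lim_seq_incr_1 (fun M => harmonic s M - 0)).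
    apply is_lim_seq_ext with (sum_f_R0 (fun k => / INR (S k) ^ s)).
    { intros M. rewrite harmonic_sum_f_R0_S. ring. }
    apply is_lim_seq_Series, ex_series_zeta. lia.
Qed.

Lemma harmonic_incr (s m n : nat) : (m <= n)%nat -> harmonic s m <= harmonic s n.
Proof.
  induction 1 as [|n _ IH]; [lra|]. rewrite harmonic_S.
  assert (0 < / INR (S n) ^ s); [|lra].
  apply Rinv_0_lt_compat, pow_lt, lt_0_INR. lia.
Qed.

Lemma harmonic_1_subadd (a d : nat) : harmonic 1 (a + d) <= harmonic 1 a + harmonic 1 d.
Proof.
  induction d as [|d IH].
  - rewrite Nat.add_0_r, harmonic_0. lra.
  - rewrite Nat.add_succ_r, !harmonic_S.
    assert (/ INR (S (a + d)) ^ 1 <= / INR (S d) ^ 1); [|lra].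
    rewrite !pow_1. apply Rinv_le_contravar; [apply lt_0_INR; lia|].
    apply le_INR. lia.
Qed.

(** The uniform bound needed for [tannery]. At [s = 1] it must grow with [n], since [N - n] may be
    small while the cutoff is of size [log N]. *)
Lemma harmonic_cutoff_bound (s : nat) : (0 < s)%nat ->
  exists C, forall N n, (n <= N)%nat ->
    Rabs (harmonic s (N - n) - cutoff N s) <= C * (harmonic 1 n + 1).
Proof.
  intros Hs. unfold cutoff. destruct (Nat.eqb_spec s 1) as [->|Hne].
  (* By subadditivity the difference is at least [- 2 log 2 - H_n - 1], and by [H7] it is not
     positive. *)
  - exists (2 * ln 2 + 1). intros N n Hn.
    assert (H1 := harmonic_node_sum_bounds N).
    assert (H2 := harmonic_1_subadd (N - n) (S n)).
    replace (N - n + S n)%nat with (S N) in H2 by lia.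
    assert (H3 := harmonic_incr 1 (N - n) (S N) ltac:(lia)).
    assert (H4 : harmonic 1 (S n) <= harmonic 1 n + 1).
    { rewrite harmonic_S, pow_1. assert (/ INR (S n) <= 1); [|lra].
      rewrite <- Rinv_1 at 1. apply Rinv_le_contravar; [lra|].
      rewrite S_INR. assert (H := pos_INR n). lra. }
    assert (H5 := harmonic_ge_0 1 n).
    assert (H6 : 0 <= ln 2) by (rewrite <- ln_1; apply ln_le; lra).
    assert (H7 : harmonic 1 (S N) - node_sum N 1 <= 0).
    { rewrite harmonic_sum_f_R0_S. unfold node_sum. rewrite <- minus_sum.
      rewrite <- (Rmult_0_l (INR (S N))), <- sum_cte. apply sum_Rle. intros k _.
      assert (/ INR (S k) ^ 1 <= / node k ^ 1); [|lra].
      rewrite !pow_1. assert (P := node_pos k).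
      apply Rinv_le_contravar; [exact P|]. unfold node in *. lra. }
    rewrite Rabs_left1 by lra. nra.
  - exists (zeta_series s). intros N n Hn. rewrite Rminus_0_r.
    assert (H0 := harmonic_ge_0 s (N - n)). rewrite Rabs_right by lra.
    assert (H1 := harmonic_ge_0 1 n).
    assert (H2 : harmonic s (N - n) <= zeta_series s).
    { apply Rle_trans with (harmonic s (S (N - n))); [apply harmonic_incr; lia|].
      rewrite harmonic_sum_f_R0_S. apply (sum_f_R0_le_Series (fun k => / INR (S k) ^ s)).
      - intros k. left. apply Rinv_0_lt_compat, pow_lt, lt_0_INR. lia.
      - apply ex_series_zeta. lia. }
    nra.
Qed.

(** * Limits of the terms of the truncated identity *)

Lemma harmonic_cutoff_node_lim (s e : nat) : (0 < s)%nat -> (1 < e)%nat ->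
  is_lim_seq (fun N => sum_f_R0 (fun n => (harmonic s (N - n) - cutoff N s) * / node n ^ e) N)
    (zeta s * t_tilde e).
Proof.
  intros Hs He. destruct (harmonic_cutoff_bound s Hs) as [C HC].
  replace (zeta s * t_tilde e) with (Series (fun n => zeta s * / node n ^ e)).
  - apply (tannery (fun N n => (harmonic s (N - n) - cutoff N s) * / node n ^ e)
      (fun n => C * ((harmonic 1 n + 1) * / node n ^ e))).
    + intros N n Hn. assert (H := inv_node_pow_pos n e).
      rewrite Rabs_mult, (Rabs_right (/ _)), <- Rmult_assoc by lra.
      apply Rmult_le_compat_r; [lra|]. now apply HC.
    + apply (ex_series_scal C (fun n => (harmonic 1 n + 1) * / node n ^ e)).
      now apply ex_series_harmonic_node.
    + intros n. apply is_lim_seq_mult'; [now apply harmonic_cutoff_lim|].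
      apply is_lim_seq_const.
  - rewrite Series_scal_l. unfold t_tilde.
    destruct (Nat.eqb_spec e 1); [lia|reflexivity].
Qed.

(** By [gap_sum_harmonic] each gap sum splits: the part with [H_(N-n)] tends to products of [zeta]
    and [t_tilde], the part with [H_n] to [harmonic_sum]. *)
Lemma cross_sum_lim (m p q : nat) : (0 < p)%nat -> (1 < q)%nat ->
  is_lim_seq (fun N => cross_sum N m p q)
    (sum_antidiag (m - 1) (fun i j =>
       binom (p + i - 1) i * binom (q + j - 1) j
       * (-1) ^ i * zeta (p + i) * t_tilde (q + j))
     + (-1) ^ p * sum_antidiag (m - 1) (fun i j =>
       binom (p + i - 1) i * binom (q + j - 1) j * harmonic_sum (p + i) (q + j))).
Proof.
  intros Hp Hq. unfold sum_antidiag. rewrite <- sum_f_R0_scal_l, <- plus_sum.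
  apply is_lim_seq_ext with (fun N => sum_f_R0 (fun i =>
    (-1) ^ i * mchoose p i * mchoose q (m - 1 - i) *
     (sum_f_R0 (fun n => (harmonic (p + i) (N - n) - cutoff N (p + i))
                         * / node n ^ (q + (m - 1 - i))) N
      + (-1) ^ (p + i) * sum_f_R0 (fun n =>
          harmonic (p + i) n / node n ^ (q + (m - 1 - i))) N)) (m - 1)).
  - intros N. unfold cross_sum, sum_antidiag. rewrite sum_f_R0_exchange.
    apply sum_eq. intros i _.
    rewrite <- sum_f_R0_scal_l, <- plus_sum, <- sum_f_R0_scal_l.
    apply sum_eq. intros n Hn. rewrite gap_sum_harmonic by lia. unfold Rdiv. ring.
  - apply is_lim_seq_sum_f_R0. intros i _. cbv beta.
    rewrite <- !mchoose_binom by lia.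
    replace (mchoose p i * mchoose q (m - 1 - i) * (-1) ^ i * zeta (p + i) * t_tilde (q + (m - 1 - i))
      + (-1) ^ p * (mchoose p i * mchoose q (m - 1 - i) * harmonic_sum (p + i) (q + (m - 1 - i))))
    with ((-1) ^ i * mchoose p i * mchoose q (m - 1 - i) *
      (zeta (p + i) * t_tilde (q + (m - 1 - i))
       + (-1) ^ (p + i) * harmonic_sum (p + i) (q + (m - 1 - i)))).
    + apply is_lim_seq_mult'; [apply is_lim_seq_const|].
      apply is_lim_seq_plus'; [apply harmonic_cutoff_node_lim; lia|].
      apply is_lim_seq_mult'; [apply is_lim_seq_const|].
      apply (is_lim_seq_Series (fun n => harmonic (p + i) n / node n ^ (q + (m - 1 - i)))).
      apply ex_series_harmonic_sum; lia.
    (* The sign [(-1) ^ i] of the residue cancels the one in [(-1) ^ (p + i)], so only [(-1) ^ p] is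
       left in front of the harmonic sums. *)
    + rewrite pow_add. assert (E := pow_m1_sqr i).
      set (a := (-1) ^ i) in *. set (b := (-1) ^ p).
      set (u := mchoose p i). set (v := mchoose q _). set (z := zeta _ * t_tilde _).
      set (h := harmonic_sum _ _).
      transitivity (u * v * a * z + b * (a * a) * (u * v * h)); [ring|].
      rewrite E. unfold z. ring.
Qed.

Theorem theorem5p1 (m p q : nat)
  (hm : (0 < m)%nat) (hp : (0 < p)%nat) (hq : (1 < q)%nat) :
  (-1) ^ (m - 1) *
    sum_antidiag (p - 1) (fun i j =>
      binom (m + i - 1) i * binom (q + j - 1) j * harmonic_sum (m + i) (q + j))
  + (-1) ^ (p - 1) *
    sum_antidiag (m - 1) (fun i j =>
      binom (p + i - 1) i * binom (q + j - 1) j * harmonic_sum (p + i) (q + j))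
  = binom (p + q + m - 2) (q - 1) * t_tilde (p + q + m - 1)
    + sum_antidiag (p - 1) (fun i j =>
        binom (m + i - 1) i * binom (q + j - 1) j
        * (-1) ^ i * zeta (m + i) * t_tilde (q + j))
    + sum_antidiag (m - 1) (fun i j =>
        binom (p + i - 1) i * binom (q + j - 1) j
        * (-1) ^ i * zeta (p + i) * t_tilde (q + j))
    - sum_antidiag (q - 1) (fun i j =>
        binom (m + i - 1) i * binom (p + j - 1) j
        * t_tilde (m + i) * t_tilde (p + j)).
Proof.
  destruct m as [|m]; [lia|]. destruct p as [|p]; [lia|].
  destruct q as [|[|q]]; [lia|lia|].
  assert (L0 : is_lim_seq (fun N => sum_antidiag (S q) (fun i j =>
      mchoose (S m) i * mchoose (S p) j
      * (node_sum N (S m + i) - cutoff N (S m + i))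
      * (node_sum N (S p + j) - cutoff N (S p + j))))
    (sum_antidiag (S q) (fun i j =>
      binom (S m + i - 1) i * binom (S p + j - 1) j
      * t_tilde (S m + i) * t_tilde (S p + j)))).
  { apply is_lim_seq_sum_f_R0. intros i _.
    rewrite <- !mchoose_binom by lia.
    apply is_lim_seq_mult'; [apply is_lim_seq_mult'; [apply is_lim_seq_const|]|];
      apply node_sum_cutoff_lim; lia. }
  assert (L1 : is_lim_seq (fun N => node_sum N (S m + S p + S q))
    (t_tilde (S m + S p + S q))).
  { apply is_lim_seq_ext with
      (fun N => node_sum N (S m + S p + S q) - cutoff N (S m + S p + S q)).
    - intros N. change (S m + S p)%nat with (S (m + S p)). rewrite cutoff_SS. ring.
    - apply node_sum_cutoff_lim. lia. }
  assert (L2 := cross_sum_lim (S m) (S p) (S (S q)) ltac:(lia) ltac:(lia)).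
  assert (L3 := cross_sum_lim (S p) (S m) (S (S q)) ltac:(lia) ltac:(lia)).
  assert (L4 := is_lim_seq_plus' _ _ _ _ (is_lim_seq_plus' _ _ _ _
    (is_lim_seq_mult' _ _ _ _
      (is_lim_seq_const (mchoose (S m + S p) (S q))) L1) L2) L3).
  (* [L0] and [L4] now give limits of the same sequence, so these agree. *)
  apply (is_lim_seq_ext _ _ _ (fun N => truncated_identity N m p q)) in L0.
  apply is_lim_seq_unique in L0. apply is_lim_seq_unique in L4.
  rewrite L0 in L4. apply Rbar_finite_eq in L4.
  replace (S p + S (S q) + S m - 2)%nat with (S m + S p + S q - 1)%nat by lia.
  replace (S p + S (S q) + S m - 1)%nat with (S m + S p + S q)%nat by lia.
  replace (S (S q) - 1)%nat with (S q) by lia.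
  rewrite <- mchoose_binom by lia.
  replace (S m - 1)%nat with m in * by lia.
  replace (S p - 1)%nat with p in * by lia.
  (* Unfolding [(-1) ^ S m] as [-1 * (-1) ^ m], and likewise for [p], produces the signs with which
     the harmonic sums move to the left side. *)
  simpl pow in L4. lra.
Qed.
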